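(* Let $G$ be a finitely generated group with any finite collection $\{X_i\mid i=1,\ldots,m\}$ of $H_i$-almost invariant subsets, where each $H_i$ is finitely generated, each $X_i$ is nontrivial, and $\bigcup_{i=1}^m\Sigma(X_i)$ is in very good position. Let $\{\sigma_j\mid j=1,\ldots,n\}$ be any finite collection of pairwise non-isomorphic splittings of $G$. For each $j$, let $Y_j$ be a $K_j$-almost invariant set arising from $\sigma_j$, where each $K_j$ is not finitely generated. Assume that $\{X_1,\ldots,X_m,Y_1,\ldots,Y_n\}$ satisfies sandwiching. Then $\{X_1,\ldots,X_m,Y_1,\ldots,Y_n\}$ can be put in very good position; that is, there exist $H_i$-almost invariant sets $X'_i$ that are $H_i$-almost equal to $X_i$ and $K_j$-almost invariant sets $Y'_j$ that are $K_j$-almost equal to $Y_j$ such that $\bigcup_{i=1}^m\Sigma(X'_i)\cup\bigcup_{j=1}^n\Sigma(Y'_j)$ is in very good position.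
   Context: For $X\subset G$, $X^*=G\setminus X$, $\Sigma(X)=\{gX,gX^*\mid g\in G\}$, $\mathrm{Stab}(X)=\{g: gX=X\}$. A subset of $G$ is $H$-finite if it is contained in finitely many right cosets $Hg_i$. Two subsets are $H$-almost equal if their symmetric difference is $H$-finite. $X\subset G$ is $H$-almost invariant if $hX=X$ for all $h\in H$, and $Xg$ is $H$-almost equal to $X$ for all $g\in G$; it is nontrivial if neither $X$ nor $X^*$ is $H$-finite. The corners of a pair $(A,B)$ are $A\cap B$, $A\cap B^*$, $A^*\cap B$, $A^*\cap B^*$. A $G$-tree is a simplicial tree with a simplicial $G$-action that inverts no edge. A splitting of $G$ is a $G$-tree $T$ with no global fixed point such that $G\backslash T$ has exactly one edge. Two splittings are isomorphic if their trees are $G$-equivariantly isomorphic. A $K$-almost invariant set arising from the splitting is a set $Y=\{g\in G : e \text{ points away from } gv\}$, where $v$ is a vertex of $T$, $e$ is a directed edge of $T$, and $K=\mathrm{Stab}(e)=\mathrm{Stab}(Y)$; ''$e$ points away from $gv$'' means that $gv$ lies in the component of $T$ minus the interior of $e$ containing the initial vertex of $e$. For translates $A,B$ of these almost invariant sets or their complements, a corner of $(A,B)$ is small if it is $\mathrm{Stab}(A)$-finite (equivalently, since $G$ is finitely generated, $\mathrm{Stab}(B)$-finite); $A$ crosses $B$ if no corner is small; $A\leq B$ means that $A\cap B^*$ is empty or is the only small corner of $(A,B)$. A collection of such sets is in good position if whenever two corners of a pair $(A,B)$ of its elements are small, one of these small corners is empty. It is in very good position if it is in good position and for all its elements $A,B$: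 $A\subset B$ if and only if $A\leq B$. Sandwiching: for almost invariant sets $Z_1,\ldots,Z_r$, $Z_p$ is sandwiched by $Z_q$ if either there exist $A,B\in\Sigma(Z_q)$ with $A\leq Z_p\leq B$, or $Z_p$ crosses every element of $\Sigma(Z_q)$. $\{Z_1,\ldots,Z_r\}$ satisfies sandwiching if $Z_p$ is sandwiched by $Z_q$ for all $p,q$. (Under the hypotheses of the claim, $\leq$ is a partial order on $\bigcup_i\Sigma(X_i)\cup\bigcup_j\Sigma(Y_j)$.) *)

(* Defs.v *)
From HB Require Import structures.
From mathcomp Require Import all_boot.
From mathcomp Require Import boolp classical_sets functions cardinality.

Set Implicit Arguments.
Unset Strict Implicit.
Unset Printing Implicit Defensive.

Local Open Scope classical_set_scope.
Local Open Scope group_scope.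

Section AlmostInvariantSets.
Variable G : groupType.
Implicit Types (g : G) (H X Y A B : set G).

Definition ltrans g X : set G := [set g * x | x in X].

Definition rtrans X g : set G := [set x * g | x in X].

Definition subgroup H : Prop :=
  [/\ H 1, forall x y, H x -> H y -> H (x * y) & forall x, H x -> H x^-1].

Definition finitely_generated H : Prop :=
  exists2 S : set G, finite_set S & smallest subgroup S = H.

Definition Sigma X : set (set G) :=
  [set A | exists g, A = ltrans g X \/ A = ltrans g (~` X)].

Definition Stab X : set G := [set g | ltrans g X = X].

(* [rtrans H g] is the right coset Hg. *)
Definition Hfinite H X : Prop :=
  exists2 F : set G, finite_set F & X `<=` \bigcup_(g in F) rtrans H g.

Definition almost_equal H X Y : Prop := Hfinite H (X `+` Y).

Definition almost_invariant H X : Prop :=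
  (forall h, H h -> ltrans h X = X) /\
  (forall g, almost_equal H (rtrans X g) X).

Definition nontrivial H X : Prop := ~ Hfinite H X /\ ~ Hfinite H (~` X).

(* The four corners of (A, B) are indexed by pairs of booleans, [true] standing
   for the set itself and [false] for its complement, so that distinct corners
   mean distinct indices, even if they happen to be equal as sets. *)
Definition side (b : bool) X : set G := if b then X else ~` X.

Definition corner A B (c : bool * bool) : set G := side c.1 A `&` side c.2 B.

Definition small_corner A B (c : bool * bool) : Prop :=
  Hfinite (Stab A) (corner A B c).

Definition crosses A B : Prop := forall c, ~ small_corner A B c.

Definition ai_le A B : Prop :=
  corner A B (true, false) = set0 \/
  (forall c, small_corner A B c <-> c = (true, false)).

Definition good_position (C : set (set G)) : Prop :=
  forall A B, C A -> C B -> forall c d, c != d ->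
    small_corner A B c -> small_corner A B d ->
    corner A B c = set0 \/ corner A B d = set0.

Definition very_good_position (C : set (set G)) : Prop :=
  good_position C /\
  (forall A B, C A -> C B -> (A `<=` B <-> ai_le A B)).

(* [sandwiched_by X Y]: X is sandwiched by Y. *)
Definition sandwiched_by X Y : Prop :=
  (exists A B, [/\ Sigma Y A, Sigma Y B, ai_le A X & ai_le X B]) \/
  (forall B, Sigma Y B -> crosses X B).

Definition satisfies_sandwiching (I : Type) (Z : I -> set G) : Prop :=
  forall p q, sandwiched_by (Z p) (Z q).

End AlmostInvariantSets.

(* Simplicial trees are encoded as simple graphs. In [path], a backtracking
   x - y - x is a [ucycle] of size 2, hence the bound in the last clause. *)
Definition is_tree (V : eqType) (adj : rel V) : Prop :=
  [/\ inhabited V,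
      irreflexive adj,
      symmetric adj,
      forall u v, exists2 p, path adj u p & last u p = v
    & forall p, ucycle adj p -> (size p <= 2)%N].

Record gtree (G : groupType) := GTree {
  vertex : eqType;
  adj : rel vertex;
  act : G -> vertex -> vertex;
  adj_tree : is_tree adj;
  act1 : forall x, act 1 x = x;
  actM : forall g h x, act (g * h) x = act g (act h x);
  act_adj : forall g x y, adj (act g x) (act g y) = adj x y;
  act_noninv : forall g x y, adj x y -> ~ (act g x = y /\ act g y = x)
}.

Section Splittings.
Variable G : groupType.
Implicit Type T : gtree G.

(* As no edge is inverted, a group element fixing a point in the interior of an
   edge fixes its end vertices: it is enough to exclude global fixed vertices.
   The second and third clauses say that the quotient graph has an edge, and
   only one. *)
Definition is_splitting T : Prop :=
  [/\ ~ (exists v : vertex T, forall g, act g v = v),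
      exists x y : vertex T, adj x y
    & forall x y x' y' : vertex T, adj x y -> adj x' y' ->
        exists g, (act g x = x' /\ act g y = y') \/
                  (act g x = y' /\ act g y = x')].

Definition gtree_iso (T1 T2 : gtree G) : Prop :=
  exists f : vertex T1 -> vertex T2,
    [/\ bijective f,
        forall g x, f (act g x) = act g (f x)
      & forall x y, adj (f x) (f y) = adj x y].

(* A directed edge is given by its initial vertex [s] and terminal vertex [t].
   [points_away s t w]: w is in the component of s once the interior of the
   edge is removed. *)
Definition adj_minus T (s t : vertex T) : rel (vertex T) :=
  [rel x y | [&& adj x y, (x, y) != (s, t) & (x, y) != (t, s)]].

Definition points_away T (s t w : vertex T) : Prop :=
  exists2 p, path (adj_minus s t) s p & last s p = w.

Definition arises_from T (K Y : set G) : Prop :=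
  exists v s t : vertex T,
    [/\ adj s t,
        Y = [set g | points_away s t (act g v)],
        K = [set g | act g s = s /\ act g t = t]
      & K = Stab Y].

End Splittings.

(* Main.v *)
(* The set [A] is recovered from the principal ultrafilter [V1] of the sets
   containing [1], as [x] is in [A] iff [x^-1 A] is in [V1]. If an ultrafilter [V]
   for the order [ai_le] differs from [V1] by finitely many sets only, then the sets
   [A' = {x | x^-1 A \in V}] are almost equal to the sets [A] and are in very good
   position, provided that the sets [A] are in good position. Such a [V] exists as soon
   as finitely many [A] containing [1] lie below some [B] not containing [1]. By nesting,
   when one of the orbits comes from a splitting, such [B] (or dually such [A]) form
   a chain; sandwiching bounds it by some [A2] in the orbit of [A], and only finitely
   many translates of [A] separate [1] from a point outside [A2].

   Good position may only fail for equivalent sets. No [X i] is equivalent to a [Y j],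
   because [H i] is finitely generated and [K j] is not. If [Y j] is equivalent to a
   translate of [Y k], or to its complement, then the latter has stabilizer [K j], and
   it can be used instead of [Y j]. *)

Require Import Defs.
From HB Require Import structures.
From mathcomp Require Import all_boot.
From mathcomp Require Import boolp classical_sets functions cardinality.

Local Open Scope classical_set_scope.

Set Implicit Arguments.
Unset Strict Implicit.
Unset Printing Implicit Defensive.

(** * Translates, finiteness over a subgroup, almost invariance *)

Section AlmostInvariant.
Local Open Scope group_scope.
Variable G : groupType.
Implicit Types (g h x y : G) (H L X Y Z A B C S : set G).

Lemma ltransE g X : ltrans g X = [set x | X (g^-1 * x)].
Proof.
apply/seteqP; split=> [_ [x Xx <-]|x /= Xx]; first by rewrite /= mulKg.
by exists (g^-1 * x); rewrite ?mulVKg.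
Qed.

Lemma rtransE g X : rtrans X g = [set x | X (x * g^-1)].
Proof.
apply/seteqP; split=> [_ [x Xx <-]|x /= Xx]; first by rewrite /= mulgK.
by exists (x * g^-1); rewrite ?mulgVK.
Qed.

Lemma ltrans1 X : ltrans 1 X = X.
Proof. by rewrite ltransE invg1; apply/seteqP; split=> x /=; rewrite mul1g. Qed.

Lemma ltransM g h X : ltrans g (ltrans h X) = ltrans (g * h) X.
Proof.
by rewrite !ltransE; apply/seteqP; split=> x /=; rewrite invgM mulgA.
Qed.

Lemma ltransK g : cancel (@ltrans G g) (ltrans g^-1).
Proof. by move=> X; rewrite ltransM mulVg ltrans1. Qed.

Lemma ltransVK g : cancel (@ltrans G g^-1) (ltrans g).
Proof. by move=> X; rewrite ltransM mulgV ltrans1. Qed.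

Lemma ltransC g X : ltrans g (~` X) = ~` ltrans g X.
Proof. by rewrite !ltransE. Qed.

Lemma ltrans_sub g X Y : X `<=` Y -> ltrans g X `<=` ltrans g Y.
Proof. by move=> sXY; rewrite !ltransE => x /=; apply: sXY. Qed.

Lemma Stab_subgroup X : subgroup (Stab X).
Proof.
split=> [|x y /= sx sy|x /= sx]; first exact: ltrans1.
  by rewrite /Stab /= -ltransM sy sx.
by rewrite /Stab /= -{1}sx ltransK.
Qed.

Lemma StabC X : Stab (~` X) = Stab X.
Proof.
apply/seteqP; split=> g /=; rewrite /Stab /= ltransC; last by move=> ->.
exact: setC_inj.
Qed.

Lemma Stab_mem X g x : Stab X g -> X (g * x) <-> X x.
Proof. by rewrite /Stab /= => sg; rewrite -{1}sg ltransE /= mulKg. Qed.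

Lemma Stab_ltrans g X : Stab (ltrans g X) = [set x | Stab X (g^-1 * x * g)].
Proof.
apply/seteqP; split=> x; rewrite /Stab /= ltransM => sx.
  by rewrite -!mulgA -ltransM sx ltransK.
by rewrite -{2}sx ltransM !mulgA mulgV mul1g.
Qed.

Lemma Hfinite_sub H X Y : X `<=` Y -> Hfinite H Y -> Hfinite H X.
Proof. by move=> sXY [F finF sY]; exists F => // x /sXY/sY. Qed.

Lemma Hfinite_subl H L X : H `<=` L -> Hfinite H X -> Hfinite L X.
Proof.
move=> sHL [F finF sX]; exists F => // x /sX[f Ff [h Hh <-]].
by exists f => //; exists h => //; apply: sHL.
Qed.

Lemma Hfinite0 H : Hfinite H set0.
Proof. by exists set0. Qed.

Lemma Hfinite_setU H X Y : Hfinite H X -> Hfinite H Y -> Hfinite H (X `|` Y).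
Proof.
move=> [F finF sX] [E finE sY]; exists (F `|` E); first by rewrite finite_setU.
by move=> x [/sX|/sY] [f Ff fx]; exists f => //; [left|right].
Qed.

Lemma Hfinite_rtrans H X g : Hfinite H X -> Hfinite H (rtrans X g).
Proof.
move=> [F finF sX]; exists [set f * g | f in F]; first exact: finite_image.
move=> _ [x /sX[f Ff [h Hh <-]] <-].
by exists (f * g); [exists f|exists h => //; rewrite mulgA].
Qed.

Lemma Hfinite_trans L H X : Hfinite L H -> Hfinite H X -> Hfinite L X.
Proof.
move=> [E finE sH] [F finF sX].
exists [set e * f | e in E & f in F]; first exact: finite_image2.
move=> x /sX[f Ff [h /sH[e Ee [l Ll <-]] <-]].
by exists (e * f); [exists e => //; exists f|exists l => //; rewrite mulgA].
Qed.

Lemma Hfinite_ltrans H X g : Hfinite H X ->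
  Hfinite [set x | H (g^-1 * x * g)] (ltrans g X).
Proof.
move=> [F finF sX]; exists [set g * f | f in F]; first exact: finite_image.
move=> _ [x /sX[f Ff [h Hh <-]] <-].
exists (g * f); first by exists f.
by exists (g * h * g^-1); rewrite /= !mulgA mulgVK // mulVg mul1g.
Qed.

(** Two points [x], [y] lie in the same right coset of [Stab A] iff [x^-1 A = y^-1 A], so finiteness
    over the stabilizer is a count of translates. *)
Lemma Hfinite_Stab A S :
  Hfinite (Stab A) S <-> finite_set [set ltrans x^-1 A | x in S].
Proof.
split=> [[F finF sS]|finS].
  apply: (@sub_finite_set _ _ [set ltrans x^-1 A | x in F]); last exact: finite_image.
  move=> _ [_ /sS[f Ff [h sh <-]] <-]; exists f => //.
  have {}sh : ltrans h A = A by [].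
  by rewrite invgM -ltransM -[in RHS]sh ltransK.
pose r (B : set G) : G := xget 1 [set x | ltrans x^-1 A = B].
exists (r @` [set ltrans x^-1 A | x in S]); first exact: finite_image.
move=> x Sx; exists (r (ltrans x^-1 A)); first by exists (ltrans x^-1 A) => //; exists x.
rewrite rtransE /=.
have rx : ltrans (r (ltrans x^-1 A))^-1 A = ltrans x^-1 A.
  by apply: (@xgetPex _ 1 [set y | ltrans y^-1 A = ltrans x^-1 A]); exists x.
by rewrite /Stab /= -ltransM rx ltransVK.
Qed.

Lemma almost_equal_sym H X Y : almost_equal H X Y -> almost_equal H Y X.
Proof. by rewrite /almost_equal setYC. Qed.

Lemma almost_equal_trans H X Y Z :
  almost_equal H X Y -> almost_equal H Y Z -> almost_equal H X Z.
Proof.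
move=> XY YZ; apply: Hfinite_sub (Hfinite_setU XY YZ) => x /= xXZ.
have [Yx|Yx] := pselect (Y x); tauto.
Qed.

Lemma almost_equalC H X Y : almost_equal H X Y -> almost_equal H (~` X) (~` Y).
Proof.
by apply: Hfinite_sub => x /=; have [? ?] := (pselect (X x), pselect (Y x)); tauto.
Qed.

Lemma almost_equal_rtrans H X Y g :
  almost_equal H X Y -> almost_equal H (rtrans X g) (rtrans Y g).
Proof. by move/(Hfinite_rtrans g); rewrite /almost_equal !rtransE. Qed.

Lemma almost_invariantC H X : almost_invariant H X -> almost_invariant H (~` X).
Proof.
move=> [sX aX]; split=> [h Hh|g]; first by rewrite ltransC sX.
by have := almost_equalC (aX g); rewrite !rtransE.
Qed.

Lemma almost_invariant_sub H X : almost_invariant H X -> H `<=` Stab X.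
Proof. by case. Qed.

Lemma almost_invariant_cut H X c : almost_invariant H X ->
  Hfinite H [set x | X x /\ ~ X (x * c)].
Proof.
move=> [_ /(_ c^-1)]; apply: Hfinite_sub => x /= [Xx nXx].
by right; rewrite rtransE /= invgK.
Qed.

Lemma almost_equal_ai H X Y : H `<=` Stab Y ->
  almost_equal H Y X -> almost_invariant H X -> almost_invariant H Y.
Proof.
move=> sHY eYX [sX aX]; split=> [|g]; first by [].
apply: almost_equal_trans (almost_equal_rtrans g eYX) _.
exact: almost_equal_trans (aX g) (almost_equal_sym eYX).
Qed.

(** Take [y] in [Y] and [z] outside. For [k] in [Stab Y], [k y] is in [Y] and [k z] is not; so one
    of them is in the symmetric difference of [X] and [Y], or the step from [k y] to [k z] leaves
    [X]. Each case allows only an [H]-finite set of [k]. *)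
Lemma Stab_Hfinite H X Y : almost_invariant H X -> almost_equal H X Y ->
  Y !=set0 -> ~` Y !=set0 -> Hfinite H (Stab Y).
Proof.
move=> aX eXY [y Yy] [z nYz].
have := Hfinite_setU (Hfinite_setU (Hfinite_rtrans y^-1 eXY)
  (Hfinite_rtrans z^-1 eXY)) (Hfinite_rtrans y^-1 (almost_invariant_cut (y^-1 * z) aX)).
apply: Hfinite_sub => k sk; rewrite !rtransE /= !invgK !mulgA mulgK.
have Yky : Y (k * y) by apply/(Stab_mem _ sk).
have nYkz : ~ Y (k * z) by move/(Stab_mem _ sk).
have [? ?] := (pselect (X (k * y)), pselect (X (k * z))); tauto.
Qed.

Lemma nontrivial_neq0 H X : nontrivial H X -> X !=set0 /\ ~` X !=set0.
Proof.
move=> [nX nXc]; split; apply/set0P/eqP => X0; [apply: nX|apply: nXc];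
  by rewrite X0; apply: Hfinite0.
Qed.

End AlmostInvariant.

(** * Small corners and the relation [ai_le] *)

Section SmallCorners.
Local Open Scope group_scope.
Variable G : groupType.
Implicit Types (g h x y : G) (H L X Y Z A B C S : set G).

(* A nontrivial [H]-almost invariant set has stabilizer [H]-finite, so [H] can be
   replaced by the stabilizer. *)
Definition ntai A : Prop := almost_invariant (Stab A) A /\ nontrivial (Stab A) A.

Definition small_meet A B : Prop := Hfinite (Stab A) (A `&` B).

Lemma ntai_of H X : almost_invariant H X -> nontrivial H X -> ntai X.
Proof.
move=> aX nX; have sHX := almost_invariant_sub aX.
have [X0 Xc0] := nontrivial_neq0 nX.
have fS : Hfinite H (Stab X).
  by apply: (Stab_Hfinite aX _ X0 Xc0); rewrite /almost_equal setYK; apply: Hfinite0.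
split; last by split=> /(Hfinite_trans fS); [exact: nX.1|exact: nX.2].
by split=> // g; apply: Hfinite_subl sHX (aX.2 g).
Qed.

Lemma ntaiC A : ntai A -> ntai (~` A).
Proof.
rewrite /ntai StabC => -[aA [nA nAc]].
by split; [exact: almost_invariantC|rewrite /nontrivial setCK].
Qed.

Lemma ntai_ltrans g A : ntai A -> ntai (ltrans g A).
Proof.
have StabV h B : [set x | Stab (ltrans h B) (h^-1^-1 * x * h^-1)] = Stab B.
  by rewrite -Stab_ltrans ltransK.
move=> [[_ aA] [nA nAc]]; split; first split=> // x.
  have := Hfinite_ltrans g (aA x); rewrite -Stab_ltrans /almost_equal; congr Hfinite.
  by rewrite !(rtransE, ltransE); apply/seteqP; split=> y /=; rewrite !mulgA.
by split=> /(Hfinite_ltrans g^-1); rewrite StabV -?ltransC ltransK.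
Qed.

Lemma ntai_Sigma X A : ntai X -> Sigma X A -> ntai A.
Proof. by move=> nX [g [->|->]]; apply: ntai_ltrans => //; apply: ntaiC. Qed.

Lemma ntai_almost_equal A B : ntai A -> Stab A `<=` Stab B ->
  almost_equal (Stab A) B A -> Hfinite (Stab A) (Stab B) /\ ntai B.
Proof.
move=> [aA [nA nAc]] sAB eBA.
have aB : almost_invariant (Stab A) B by apply: almost_equal_ai eBA aA.
have nB : nontrivial (Stab A) B.
  split=> fB; [apply: nA|apply: nAc]; apply: Hfinite_sub (Hfinite_setU eBA fB) => x /=;
  have [? ?] := (pselect (A x), pselect (B x)); tauto.
have [B0 Bc0] := nontrivial_neq0 nB; split; last exact: ntai_of aB nB.
exact: (Stab_Hfinite aA (almost_equal_sym eBA) B0 Bc0).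
Qed.

Lemma Hfinite_bigcup A (F : set G) (P : G -> set G) : finite_set F ->
  (forall f, F f -> Hfinite (Stab A) (P f)) -> Hfinite (Stab A) (\bigcup_(f in F) P f).
Proof.
move=> finF finP; apply/Hfinite_Stab.
apply: (@sub_finite_set _ _ (\bigcup_(f in F) [set ltrans x^-1 A | x in P f])).
  by move=> _ [x [f Ff Px] <-]; exists f => //; exists x.
by apply: bigcup_finite => // f /finP /Hfinite_Stab.
Qed.

(* Away from [P1], a point of [A `&` C] is [k * f] with [k] in [Stab C] and [f] in
   a finite set. For a fixed [d] in [C] outside [P2], the point [k * d] of [C] is
   either outside [A] or in [P1], and lies at a bounded distance from [k * f]. *)
Lemma small_meet_cover A C (P1 P2 : set G) : ntai A -> ntai C ->
  A `&` C `<=` P1 `|` P2 -> Hfinite (Stab A) P1 -> Hfinite (Stab C) P2 ->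
  small_meet A C.
Proof.
move=> [aA _] [aC [nC _]] sAC f1 [F finF sP2].
have [d [Cd nd]] : exists d, C d /\ ~ (\bigcup_(g in F) rtrans (Stab C) g) d.
  apply: contrapT => nd; apply: nC; exists F => // x Cx.
  by apply: contrapT => nx; apply: nd; exists x.
apply: (@Hfinite_sub _ _ _ (P1 `|` \bigcup_(f in F)
  ([set x | A x /\ ~ A (x * (f^-1 * d))] `|` rtrans P1 (d^-1 * f)))); last first.
  apply: Hfinite_setU => //; apply: Hfinite_bigcup => // f _; apply: Hfinite_setU.
    exact: almost_invariant_cut.
  exact: Hfinite_rtrans.
move=> x [Ax Cx]; have [//|/sP2[f Ff [k sk kf]]] := sAC x (conj Ax Cx); first by left.
right; exists f => //; rewrite rtransE /=.
have -> : x * (f^-1 * d) = k * d by rewrite -kf !mulgA mulgK.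
have -> : x * (d^-1 * f)^-1 = k * d by rewrite -kf invgM invgK !mulgA mulgK.
have [Akd|] := pselect (A (k * d)); last by left.
right; have Ckd : C (k * d) by apply/(Stab_mem _ sk).
have [//|/sP2[e Fe [l sl le]]] := sAC _ (conj Akd Ckd).
have [_ SM SV] := Stab_subgroup C.
case: nd; exists e => //; exists (k^-1 * l); first by apply: SM => //; apply: SV.
by rewrite -mulgA le mulKg.
Qed.

Lemma small_meetC A B : ntai A -> ntai B -> small_meet A B -> small_meet B A.
Proof.
move=> nA nB sAB.
apply: (@small_meet_cover B A set0 (A `&` B)) => //; last exact: Hfinite0.
by move=> x [? ?]; right.
Qed.

Lemma small_meet_absurd A B : ntai A -> small_meet A B -> small_meet A (~` B) -> False.
Proof.
move=> [_ [nA _]] s1 s2; apply: nA; apply: Hfinite_sub (Hfinite_setU s1 s2) => x Ax.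
by have [?|?] := pselect (B x); [left|right].
Qed.

(** [A \ C] is covered by [A \ B], finite over [Stab A], and [B \ C], finite over [Stab C]; this is
    why [small_meet_cover] allows two stabilizers. *)
Lemma small_meet_trans A B C : ntai A -> ntai B -> ntai C ->
  small_meet A (~` B) -> small_meet B (~` C) -> small_meet A (~` C).
Proof.
move=> nA nB nC sAB sBC; have nCc := ntaiC nC.
apply: (@small_meet_cover A (~` C) (A `&` ~` B) (~` C `&` B)) => //.
  by move=> x [Ax nCx]; have [?|?] := pselect (B x); [right|left].
exact: small_meetC.
Qed.

Lemma small_cornerE A B c :
  small_corner A B c = small_meet (side c.1 A) (side c.2 B).
Proof.
by rewrite /small_corner /small_meet /corner; case: c => [[] b] //=; rewrite StabC.
Qed.

Lemma corner_eq0 A B c : corner A B c = set0 <-> side c.1 A `<=` side (~~ c.2) B.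
Proof.
rewrite /corner; split=> [/disjoints_subset|s].
  by case: c => a [] //=; rewrite setCK.
by apply/disjoints_subset; case: c s => a [] //=; rewrite setCK.
Qed.

(** Once [A \ B] is small, another small corner sharing a side with it would make that side trivial;
    only the opposite corner [B \ A] has to be excluded. *)
Lemma ai_leE A B : ntai A -> ntai B ->
  ai_le A B <->
  A `<=` B \/ (small_meet A (~` B) /\ ~ small_meet B (~` A)).
Proof.
move=> nA nB; have [nAc nBc] := (ntaiC nA, ntaiC nB).
split=> -[].
- by move/corner_eq0 => /=; left.
- move=> h; right; split; first by have /= := (h (true, false)).2 erefl; rewrite small_cornerE.
  move=> /(small_meetC nB nAc) s.
  by have := (h (false, true)).1; rewrite small_cornerE => /(_ s).
- by move=> sAB; left; apply/corner_eq0.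
- move=> [s ns]; right => -[a b]; rewrite small_cornerE /=; split; last by case=> -> ->.
  case: a b => [] [] //= t.
  + by case: (small_meet_absurd nA t s).
  + by case: ns; apply: small_meetC.
  + have {}s := small_meetC nA nBc s; have {}t := small_meetC nAc nBc t.
    by case: (small_meet_absurd nBc s t).
Qed.

Lemma sub_ai_le A B : A `<=` B -> ai_le A B.
Proof. by move=> sAB; left; apply/corner_eq0. Qed.

Lemma ai_le_small A B : ai_le A B -> small_meet A (~` B).
Proof.
case=> [|/(_ (true, false)) [_ /(_ erefl)]]; last by rewrite small_cornerE.
by rewrite /corner /small_meet /= => ->; apply: Hfinite0.
Qed.

(** If [C \ A] is small as well, then so are [B \ A] and [C \ B], and both inequalities must come
    from inclusions. *)
Lemma ai_le_trans A B C : ntai A -> ntai B -> ntai C ->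
  ai_le A B -> ai_le B C -> ai_le A C.
Proof.
move=> nA nB nC lAB lBC; apply/ai_leE => //.
have [sAB sBC] := (ai_le_small lAB, ai_le_small lBC).
have sAC := small_meet_trans nA nB nC sAB sBC.
have [sCA|] := pselect (small_meet C (~` A)); last by right.
left; apply: (@subset_trans _ B).
  case/ai_leE: lAB => // -[_ []]; exact: small_meet_trans sCA.
case/ai_leE: lBC => // -[_ []]; exact: small_meet_trans sAB.
Qed.

Lemma ai_leC A B : ntai A -> ntai B -> ai_le A B -> ai_le (~` B) (~` A).
Proof.
move=> nA nB; have [nAc nBc] := (ntaiC nA, ntaiC nB).
move/ai_leE => /(_ nA nB) [sAB|[s ns]]; first by apply/sub_ai_le/subsetC.
apply/ai_leE => //; right; rewrite !setCK; split; first exact: small_meetC.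
by move/(small_meetC nAc nB).
Qed.

Lemma ai_le_absurd A B : ntai A -> ai_le A B -> ai_le A (~` B) -> False.
Proof.
move=> nA /ai_le_small s /ai_le_small; rewrite setCK => t.
exact: small_meet_absurd t s.
Qed.

Lemma small_meet_ltrans g A B : small_meet A B -> small_meet (ltrans g A) (ltrans g B).
Proof.
move/(Hfinite_ltrans g); rewrite -Stab_ltrans /small_meet; congr Hfinite.
by rewrite !ltransE.
Qed.

Lemma ai_le_ltrans g A B : ntai A -> ntai B ->
  ai_le A B -> ai_le (ltrans g A) (ltrans g B).
Proof.
move=> nA nB; have [gA gB] := (ntai_ltrans g nA, ntai_ltrans g nB).
move/ai_leE => /(_ nA nB) [sAB|[s ns]]; first exact/sub_ai_le/ltrans_sub.
apply/ai_leE => //; right; split.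
  by rewrite -ltransC; apply: small_meet_ltrans.
by move/(small_meet_ltrans g^-1); rewrite ltransC !ltransK.
Qed.

End SmallCorners.

(** For an irreflexive [R] the conclusion says that nothing in [F] is above [x]; this form serves
    both inclusion and strict orders. *)
Lemma finite_quasi_maximal (T : Type) (F : set T) (R : T -> T -> Prop) :
  (forall x y z, R x y -> R y z -> R x z) -> finite_set F -> F !=set0 ->
  exists x, F x /\ forall y, F y -> R x y -> R y x.
Proof.
elim/Peq: T => T in F R *; move=> Rtr /finite_seqP[s ->] {F}.
elim: s => [|x [|z s] IHs] [y0 /= y0s]; first by [].
  by exists x; split=> [|y /=]; rewrite ?inE // => /eqP->.
have [|m [ms mmax]] := IHs; first by exists z; rewrite /= inE eqxx.
have [Rmx|nRmx] := pselect (R m x).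
  exists x; split=> [|y /=]; first by rewrite /= inE eqxx.
  rewrite inE => /orP[/eqP->//|ys] Rxy.
  exact: Rtr (mmax y ys (Rtr _ _ _ Rmx Rxy)) Rmx.
exists m; split=> [|y /=]; first by rewrite /= inE ms orbT.
by rewrite inE => /orP[/eqP->//|ys]; apply: mmax.
Qed.

(** * Ultrafilters for [ai_le] *)

Section Ultrafilter.
Local Open Scope group_scope.
Variable G : groupType.
Implicit Types (g x y : G) (X Y Z A B C : set G) (P Q E V : set (set G)).

Lemma Sigma_refl X : Sigma X X.
Proof. by exists 1; left; rewrite ltrans1. Qed.

Lemma SigmaC X A : Sigma X A -> Sigma X (~` A).
Proof. by move=> [g [->|->]]; exists g; rewrite ltransC ?setCK; [right|left]. Qed.

Lemma Sigma_ltrans g X A : Sigma X A -> Sigma X (ltrans g A).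
Proof. by move=> [h [->|->]]; exists (g * h); rewrite ltransM; [left|right]. Qed.

Lemma Sigma_sub X A : Sigma X A -> Sigma A `<=` Sigma X.
Proof.
move=> sXA B [g [->|->]]; last exact/Sigma_ltrans/SigmaC.
exact: Sigma_ltrans.
Qed.

Lemma Sigma_sym X A : Sigma X A -> Sigma A X.
Proof.
by case=> g [->|->]; exists g^-1; [left|right]; rewrite -?ltransC ltransK ?setCK.
Qed.

(** If [g W] contains [x] but not [y], then [g^-1 x] is in [W] and leaves it under right
    multiplication by [x^-1 y]; by almost invariance such points yield finitely many translates of
    [W]. *)
Lemma finite_separating Z x y : ntai Z ->
  finite_set [set A | [/\ Sigma Z A, A x & ~ A y]].
Proof.
have cut W : ntai W ->
    finite_set [set A | [/\ exists g, A = ltrans g W, A x & ~ A y]].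
  move=> [aW _].
  have /Hfinite_Stab/(finite_image (@ltrans G x)) :=
    almost_invariant_cut (x^-1 * y) aW.
  apply: sub_finite_set => _ [[g ->]]; rewrite ltransE /= => Wx Wy.
  exists (ltrans (g^-1 * x)^-1 W).
    by exists (g^-1 * x) => //; split; rewrite // -mulgA mulVKg.
  by rewrite ltransM invgM invgK mulVKg -ltransE.
move=> nZ; have : finite_set ([set A | [/\ exists g, A = ltrans g Z, A x & ~ A y]] `|`
    [set A | [/\ exists g, A = ltrans g (~` Z), A x & ~ A y]]).
  by rewrite finite_setU; split; apply: cut => //; apply: ntaiC.
by apply: sub_finite_set => A [[g [->|->]] Ax Ay]; [left|right]; split=> //; exists g.
Qed.

(** A small corner rules out the crossing alternative. The bounds of [Z] are then translated to [A],
    and exchanged if [A] comes from the complement of [Z]. *)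
Lemma sandwich_small Z W A B : ntai Z -> ntai W -> sandwiched_by Z W ->
  Sigma Z A -> Sigma W B -> small_meet A B ->
  exists B1 B2, [/\ Sigma W B1, Sigma W B2, ai_le B1 A & ai_le A B2].
Proof.
move=> nZ nW [[B1 [B2 [s1 s2 l1 l2]]] [g [->|->]] _ _|cr [g gA] sWB sAB].
- exists (ltrans g B1), (ltrans g B2); split; try exact: Sigma_ltrans.
    by apply: ai_le_ltrans => //; apply: ntai_Sigma s1.
  by apply: ai_le_ltrans => //; apply: ntai_Sigma s2.
- have [n1 n2] := (ntai_Sigma nW s1, ntai_Sigma nW s2).
  exists (ltrans g (~` B2)), (ltrans g (~` B1)).
  split; try exact/Sigma_ltrans/SigmaC;
    by apply: ai_le_ltrans; try apply: ai_leC; try apply: ntaiC.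
- have /cr {}cr := Sigma_ltrans g^-1 sWB.
  have := small_meet_ltrans g^-1 sAB.
  case: gA => ->; rewrite ltransK => s; first by case: (cr (true, true)); rewrite small_cornerE.
  by case: (cr (false, true)); rewrite small_cornerE.
Qed.

Definition nested P : Prop :=
  forall A B, P A -> P B -> exists c, corner A B c = set0.

(** What is used of a single orbit, whether it is that of an [X i] or that of a splitting. *)
Record ordered_family P : Prop := OrderedFamily {
  of_ntai : forall A, P A -> ntai A;
  ofC : forall A, P A -> P (~` A);
  of_separating : forall x y, finite_set [set A | [/\ P A, A x & ~ A y]];
  of_sub : forall A B, P A -> P B -> ai_le A B -> A `<=` B
}.

(* Obstructions to the principal ultrafilter at [1] being closed under [ai_le]. *)
Definition bad P Q A B : Prop := [/\ P A, Q B, ai_le A B, A 1 & ~ B 1].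

(* The elements [B] of bad pairs form a chain, with a largest element [B1];
   if [B1 <= A1] then all bad [A] are contained in [A1]. *)
Lemma finite_bad P Q : ordered_family P -> ordered_family Q -> nested Q ->
  (forall A B, P A -> Q B -> ai_le A B ->
     (exists2 B', Q B' & ai_le B' A) /\ (exists2 A', P A' & ai_le B A')) ->
  finite_set [set A | exists B, bad P Q A B] /\
  finite_set [set B | exists A, bad P Q A B].
Proof.
move=> fP fQ nQ sw.
have nP A : P A -> ntai A by exact: of_ntai.
have nQ' A : Q A -> ntai A by exact: of_ntai.
(* Two of the four empty corners are impossible: if [B] and [B'] were disjoint, [A] would lie in the
   complement of [A'], yet both contain 1; and [B], [B'] do not cover [G], as both miss 1. *)
have chain A B A' B' : bad P Q A B -> bad P Q A' B' -> B `<=` B' \/ B' `<=` B.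
  move=> [PA QB lAB A1 B1] [PA' QB' lAB' A1' B1'].
  have [c /corner_eq0] := nQ B B' QB QB'.
  case: c => [] [] [] /= s.
  - have [PAc QBc] := (ofC fP PA', ofC fQ QB').
    have lBA : ai_le B (~` A').
      apply: (ai_le_trans (B := ~` B')); [exact: nQ'|exact: nQ'|exact: nP|exact: sub_ai_le|].
      by apply: ai_leC => //; [exact: nP|exact: nQ'].
    suff : A `<=` ~` A' by move/(_ 1 A1).
    by apply: (of_sub fP) => //; apply: ai_le_trans lBA; auto.
  - by left.
  - by right; have := subsetC s; rewrite !setCK.
  - by case: B1'; apply: s.
have [[A0 [B0 bad0]]|nb] := pselect (exists A B, bad P Q A B); last first.
  have f0 (p : set G -> Prop) : (forall A, ~ p A) -> finite_set [set A | p A].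
    by move=> np; apply: (@sub_finite_set _ _ set0) => // A /np.
  by split; apply: f0 => [A [B b]]; apply: nb; [exists A, B|exists B, A].
have [PA0 QB0 lAB0 A01 nB01] := bad0.
have [z B0z] := (nontrivial_neq0 (nQ' _ QB0).2).1.
(* The bad [B] containing [B0] all separate [z] from 1, so they are finitely many; a maximal one is
   the largest bad [B], by [chain]. *)
have [|||B1 [[[A1 bad1] sB01] maxB1]] := @finite_quasi_maximal _
  [set B | (exists A, bad P Q A B) /\ B0 `<=` B] (fun B B' => B `<=` B').
- by move=> B B' B''; exact: subset_trans.
- apply: sub_finite_set (of_separating fQ z 1) => B [[A [PA QB _ _ nB1]] /(_ z B0z) Bz].
  by split.
- by exists B0; split=> //; exists A0.
have leB1 A B : bad P Q A B -> B `<=` B1.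
  move=> b; have [//|sB1B] := chain _ _ _ _ b bad1.
  by apply: maxB1 => //; split; [exists A|apply: subset_trans sB1B].
have [PA1 QB1 lAB1 _ _] := bad1.
have [_ [A2 PA2 lBA2]] := sw _ _ PA1 QB1 lAB1.
have [y nA2y] := (nontrivial_neq0 (nP _ PA2).2).2.
have finA : finite_set [set A | exists B, bad P Q A B].
  apply: sub_finite_set (of_separating fP 1 y) => A [B b].
  have [PA QB lAB A1' nB1] := b; split=> // Ay; apply: nA2y.
  suff /(_ y Ay) : A `<=` A2 by [].
  apply: (of_sub fP) => //; apply: ai_le_trans lBA2; auto.
  by apply: ai_le_trans lAB _; auto; apply: sub_ai_le; apply: leB1 b.
(* For each of the finitely many bad [A], a lower bound [B'] in [Q] is contained in every bad [B]
   above [A], which therefore separates [x] from 1. *)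
split=> //; have : finite_set (\bigcup_(A in [set A | exists B, bad P Q A B])
    [set B | bad P Q A B]).
  apply: bigcup_finite => // A [B [PA QB lAB A1' nB1]].
  have [[B' QB' lB'A] _] := sw _ _ PA QB lAB.
  have [x B'x] := (nontrivial_neq0 (nQ' _ QB').2).1.
  apply: sub_finite_set (of_separating fQ x 1) => B'' [_ QB'' lAB'' _ nB''1]; split=> //.
  by apply: (of_sub fQ QB' QB'') => //; apply: ai_le_trans lAB''; auto.
by apply: sub_finite_set => B [A b]; exists A => //; exists B.
Qed.

Definition mesh (E : set (set G)) : Prop :=
  [/\ forall A, E A -> ntai A, forall A, E A -> E (~` A),
      forall g A, E A -> E (ltrans g A)
    & finite_set [set A | exists B, bad E E A B]].

(** Zorn's lemma extends [U], the sets containing 1 with no set above them missing 1. If [V] and the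
    point 1 disagree on [A], then neither [A] nor its complement is in [U], so whichever contains 1
    occurs in a bad pair. *)
Lemma exists_ultrafilter E : mesh E -> exists V,
  [/\ forall A B, E A -> E B -> V A -> ai_le A B -> V B,
      forall A, E A -> V (~` A) <-> ~ V A
    & finite_set [set A | E A /\ ~ (V A <-> A 1)]].
Proof.
move=> [nE EC _ finb].
(* Zorn's lemma is applied to [W] and not to [U `|` W], the empty chain being allowed. *)
pose U : set (set G) := [set A | [/\ E A, A 1 & ~ exists B, bad E E A B]].
pose filt V := [/\ V `<=` E, forall A B, E B -> V A -> ai_le A B -> V B
  & forall A, V A -> ~ V (~` A)].
have [|W [fV maxW]] := @Zorn_bigcup _ [set W | filt (U `|` W)].
- move=> F sF totF; split.
  + by move=> A [[]//|[W FW WA]]; have [sE _ _] := sF _ FW; apply: sE; right.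
  + move=> A B EB [UA|[W FW WA]] lAB.
      left; have [EA A1 nb] := UA; split=> //.
        by apply: contrapT => B1; apply: nb; exists B.
      move=> [C [_ EC' lBC B1 nC1]]; apply: nb; exists C; split=> //.
      by apply: ai_le_trans lBC; auto.
    have [_ up _] := sF _ FW; have [] := up A B EB _ lAB; first by right.
      by left.
    by right; exists W.
  + move=> A [UA|[W FW WA]] [UAc|[W' FW' WAc]].
    * by have [[_ A1 _] [_ nA1 _]] := (UA, UAc); apply: nA1.
    * by have [_ _ /(_ A)] := sF _ FW'; apply; [left|right].
    * by have [_ _ /(_ A)] := sF _ FW; apply; [right|left].
    * have [/(_ _ WA) W'A|/(_ _ WAc) WAc'] := totF _ _ FW FW'.
        by have [_ _ /(_ A)] := sF _ FW'; apply; right.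
      by have [_ _ /(_ A)] := sF _ FW; apply; right.
set V := U `|` W in fV; have [sVE upV cV] := fV.
(* If neither [A] nor its complement were in [V], everything above [A] could be added, against
   maximality. *)
have decV A : E A -> ~ V A -> V (~` A).
  move=> EA nVA; apply: contrapT => nVAc; have nA := nE _ EA.
  apply: (maxW (W `|` [set B | E B /\ ai_le A B])).
    split; last first.
      move/(_ A) => sub; apply: nVA; right; apply: sub; right.
      by split=> //; exact: sub_ai_le.
    by move=> B; left.
  rewrite /mkset setUA -/V.
  have up C : ai_le A (~` C) -> ~ V C.
    move=> lAC VC; apply: nVAc; apply: upV (VC) _; first exact: EC.
    have nC := nE _ (sVE _ VC).
    by rewrite -[C]setCK; apply: ai_leC => //; apply: ntaiC.
  split.
  - by move=> B [/sVE|[]].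
  - move=> B C EC' [VB|[EB lAB]] lBC; first by left; apply: upV VB lBC.
    by right; split=> //; apply: ai_le_trans lBC; auto.
  - move=> B [VB|[EB lAB]] [VBc|[EBc lABc]].
    + exact: cV VB VBc.
    + exact: up lABc VB.
    + by apply: up VBc; rewrite setCK.
    + exact: ai_le_absurd lAB lABc.
exists V; split=> //.
- by move=> A B EA EB VA lAB; apply: upV lAB.
- move=> A EA; split; last exact: decV.
  by move=> VAc VA; apply: cV VA VAc.
have : finite_set ([set A | exists B, bad E E A B] `|`
    [set ~` A | A in [set A | exists B, bad E E A B]]).
  by rewrite finite_setU; split=> //; apply: finite_image.
apply: sub_finite_set => A [EA nVA]; have EAc := EC _ EA.
have [A1|nA1] := pselect (A 1).
  left; apply: contrapT => nb; apply: nVA; split=> // _.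
  by left.
right; exists (~` A); last exact: setCK.
apply: contrapT => nb; apply: nVA; split=> // VA.
by case: (cV A VA); left.
Qed.
End Ultrafilter.

(** * From an ultrafilter to very good position *)

Section VeryGoodPosition.
Local Open Scope group_scope.
Variable G : groupType.
Implicit Types (g x y : G) (X Y Z A B C : set G) (E V : set (set G)).

Lemma very_good_position_sub (C D : set (set G)) :
  C `<=` D -> very_good_position D -> very_good_position C.
Proof.
move=> sCD [gD vD]; split=> [A B CA CB|A B CA CB]; first by apply: gD; apply: sCD.
by apply: vD; apply: sCD.
Qed.

Lemma very_good_replacement E : mesh E -> good_position E ->
  exists f : set G -> set G,
  [/\ forall A, E A -> Stab A `<=` Stab (f A) /\ almost_equal (Stab A) (f A) A,
      forall g A, f (ltrans g A) = ltrans g (f A),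
      forall A, E A -> f (~` A) = ~` f A
    & very_good_position [set f A | A in E]].
Proof.
move=> mE gE; have [V [upV cV finV]] := exists_ultrafilter mE.
have [nE EC El _] := mE.
pose f A : set G := [set x | V (ltrans x^-1 A)].
have fl g A : f (ltrans g A) = ltrans g (f A).
  by rewrite [RHS]ltransE; apply/seteqP; split=> x; rewrite /f /= ltransM invgM invgK.
have fC A : E A -> f (~` A) = ~` f A.
  move=> EA; apply/seteqP; split=> x; rewrite /f /= ltransC => h; apply/cV => //;
  exact: El.
have sf A : Stab A `<=` Stab (f A).
  by move=> g; rewrite /Stab /= -fl => ->.
(* [x] is in the symmetric difference iff [V] and the point 1 disagree on [x^-1 A], so finitely many
   translates of [A] arise. *)
have ef A : E A -> almost_equal (Stab A) (f A) A.
  move=> EA; apply/Hfinite_Stab; apply: sub_finite_set finV => _ [x xA <-].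
  split; first exact: El.
  move: xA; rewrite /f /= [in X in _ <-> X]ltransE /= invgK mulg1; tauto.
have nf A : E A -> Hfinite (Stab A) (Stab (f A)) /\ ntai (f A).
  by move=> EA; apply: ntai_almost_equal => //; [apply: nE|apply: ef].
have fle A B : E A -> E B -> ai_le A B -> f A `<=` f B.
  move=> EA EB lAB x VA; apply: (upV (ltrans x^-1 A)) => //; try exact: El.
  by apply: ai_le_ltrans; auto.
(* The stabilizer may grow, but [Stab (f A)] is finite over [Stab A]; the symmetric differences
   enter the two parts of a cover. *)
have smf A B : E A -> E B -> small_meet (f A) (f B) <-> small_meet A B.
  move=> EA EB; have [nA nB] := (nE _ EA, nE _ EB).
  have [[fA nfA] [fB nfB]] := (nf _ EA, nf _ EB).
  split=> sm.
    apply: (@small_meet_cover _ A B ((f A `&` f B) `|` (f A `+` A)) (f B `+` B)) => //.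
    - move=> x [Ax Bx]; have [? ?] := (pselect (f A x), pselect (f B x)).
      rewrite /setY /=; tauto.
    - apply: Hfinite_setU; last exact: ef.
      exact: Hfinite_trans fA sm.
    - exact: ef.
  apply: (@small_meet_cover _ (f A) (f B) ((A `&` B) `|` (f A `+` A)) (f B `+` B)) => //.
  - move=> x [Ax Bx]; have [? ?] := (pselect (A x), pselect (B x)).
    rewrite /setY /=; tauto.
  - apply: Hfinite_setU; apply: (Hfinite_subl (@sf A)) => //; exact: ef.
  - by apply: (Hfinite_subl (@sf B)); apply: ef.
have Eside b A : E A -> E (side b A) by case: b => //=; apply: EC.
have fside b A : E A -> f (side b A) = side b (f A) by case: b => //=; apply: fC.
exists f; split=> //; first by move=> A EA; split; [exact: sf|exact: ef].
split.
  move=> _ _ [A EA <-] [B EB <-] c d ncd.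
  have smc e : small_corner (f A) (f B) e -> small_corner A B e.
    by rewrite !small_cornerE -!fside // => /smf; apply; apply: Eside.
  have c0 e : corner A B e = set0 -> corner (f A) (f B) e = set0.
    rewrite !corner_eq0 -!fside // => s; apply: fle; try exact: Eside.
    exact: sub_ai_le.
  by move=> /smc sc /smc sd; have [/c0|/c0] := gE A B EA EB c d ncd sc sd; [left|right].
move=> _ _ [A EA <-] [B EB <-]; split; first exact: sub_ai_le.
have [[_ nfA] [_ nfB]] := (nf _ EA, nf _ EB).
have [EAc EBc] := (EC _ EA, EC _ EB).
case/ai_leE => // -[]; rewrite -!fC // => /(smf _ _ EA EBc) sAB nsBA.
apply: fle => //; apply/ai_leE; [exact: nE|exact: nE|right].
by split=> // sBA; apply: nsBA; apply/smf.
Qed.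

End VeryGoodPosition.

(** * Half-trees cut off by an edge *)

Section Trees.
Local Open Scope group_scope.
Variables (G : groupType) (T : gtree G).
Implicit Types (g h x y : G) (a b c d s t u v w : vertex T) (p : seq (vertex T)).

Lemma adj_sym a b : adj a b = adj b a.
Proof. by have [_ _ sy _ _] := adj_tree T; rewrite sy. Qed.

Lemma adj_irr a : adj a a = false.
Proof. by have [_ ir _ _ _] := adj_tree T; rewrite ir. Qed.

Lemma actK g : cancel (@act G T g) (act g^-1).
Proof. by move=> a; rewrite -actM mulVg act1. Qed.

Lemma actVK g : cancel (@act G T g^-1) (act g).
Proof. by move=> a; rewrite -actM mulgV act1. Qed.

Lemma act_inj g : injective (@act G T g).
Proof. exact: can_inj (actK g). Qed.

Lemma adj_minusC s t : adj_minus s t =2 adj_minus t s.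
Proof. by move=> a b; rewrite /adj_minus /= [X in _ && X]andbC. Qed.

Lemma adj_minus_sym s t : symmetric (adj_minus s t).
Proof.
move=> a b; rewrite /adj_minus /= adj_sym [X in _ && X]andbC !xpair_eqE.
by rewrite [(a == t) && _]andbC [(a == s) && _]andbC.
Qed.

Lemma points_away_refl s t : points_away s t s.
Proof. by exists [::]. Qed.

Lemma points_away_step s t a b : adj_minus s t a b ->
  points_away s t a -> points_away s t b.
Proof.
move=> ab [p sp pa]; exists (rcons p b); last by rewrite last_rcons.
by rewrite rcons_path sp pa.
Qed.

Lemma points_away_ind s t (P : vertex T -> Prop) : P s ->
  (forall a b, points_away s t a -> adj_minus s t a b -> P a -> P b) ->
  forall w, points_away s t w -> P w.
Proof.
move=> Ps step w [p + <-]; elim/last_ind: p => [//|p b IHp].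
rewrite rcons_path last_rcons => /andP[sp ab].
by apply: (step (last s p)) => //; [exists p|apply: IHp].
Qed.

Lemma edge_cases s t a b : adj a b ->
  [\/ a = s /\ b = t, a = t /\ b = s | adj_minus s t a b].
Proof.
move=> ab; rewrite /adj_minus /= ab /=.
have [[-> ->]|_] := eqVneq (a, b) (s, t); first exact: Or31.
by have [[-> ->]|_] := eqVneq (a, b) (t, s); [exact: Or32|exact: Or33].
Qed.

Lemma points_away_cover s t w : points_away s t w \/ points_away t s w.
Proof.
have [_ _ _ conn _] := adj_tree T; have [p + <-] := conn s w.
elim/last_ind: p => [_|p b IHp]; first by left; apply: points_away_refl.
rewrite rcons_path last_rcons => /andP[/IHp{}IHp ab].
have [[_ ->]|[_ ->]|ab'] := edge_cases s t ab.
- by right; apply: points_away_refl.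
- by left; apply: points_away_refl.
case: IHp => h; [left|right]; apply: points_away_step h => //.
by rewrite adj_minusC.
Qed.

(** Otherwise a path from [s] to [t] avoids the edge, and the edge closes it into a cycle. *)
Lemma points_away_disjoint s t w : adj s t ->
  points_away s t w -> points_away t s w -> False.
Proof.
move=> st sw tw; have : points_away s t t.
  suff : forall w, points_away t s w -> points_away s t w -> points_away s t t.
    by apply; eassumption.
  apply: points_away_ind => [//|a b _ ab IH sb]; apply: IH.
  by apply: points_away_step sb; rewrite adj_minus_sym adj_minusC.
case=> p /shortenP[q sq uq _] qt.
have [_ _ _ _ /(_ (s :: q))] := adj_tree T.
have sqa : path (@adj G T) s q by apply: sub_path sq => a b /and3P[].
rewrite /ucycle /= rcons_path sqa qt adj_sym st /= => /(_ uq).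
(* The bound on cycles leaves at most one step: no step means [s = t], and one step would be the
   removed edge. *)
case: q sq uq qt {sqa} => [|a [|//]] /=.
  by move=> _ _ e; rewrite e adj_irr in st.
by rewrite andbT => + _ e; rewrite e /adj_minus /= !eqxx andbF.
Qed.

Lemma points_awayC s t w : adj s t -> ~ points_away s t w <-> points_away t s w.
Proof.
move=> st; split=> [nw|tw sw]; last exact: points_away_disjoint sw tw.
by have [] := points_away_cover s t w.
Qed.

Lemma points_away_act g s t w :
  points_away s t w -> points_away (act g s) (act g t) (act g w).
Proof.
elim/points_away_ind: w / => [|a b _ ab]; first exact: points_away_refl.
apply: points_away_step; move: ab; rewrite /adj_minus /= act_adj !xpair_eqE.
by rewrite !(inj_eq (@act_inj g)).
Qed.

(** The edge from [a] to [b] lies on the side of [s], so a walk from [t] within the other side never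
    traverses it. *)
Lemma points_away_sub s t a b : adj s t -> adj a b -> adj_minus s t a b ->
  points_away s t a -> points_away a b t ->
  forall w, points_away t s w -> points_away a b w.
Proof.
move=> st ab stab sa at'; have sb := points_away_step stab sa.
apply: points_away_ind => // c d tc cd; apply: points_away_step.
have [cd' _ _] := and3P cd; rewrite /adj_minus /= cd' /=; apply/andP; split; apply/eqP => -[e1 e2].
  by apply: (points_away_disjoint st sa); rewrite -e1.
by apply: (points_away_disjoint st sb); rewrite -e1.
Qed.

Lemma points_away_turn a b c : adj a b -> adj b c -> a != c ->
  forall w, points_away a b w -> points_away b c w.
Proof.
move=> ab bc ac; have ba : adj b a by rewrite adj_sym.
have nab : b != a by apply: contraTneq ba => ->; rewrite adj_irr.
have nbc : b != c by apply: contraTneq bc => ->; rewrite adj_irr.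
apply: points_away_sub => //; try exact: points_away_refl.
  by rewrite /adj_minus /= bc !xpair_eqE eqxx /= eq_sym ac (negPf nab).
apply: points_away_step (points_away_refl b c).
by rewrite /adj_minus /= ba !xpair_eqE eqxx /= ac (negPf nbc).
Qed.

Lemma separating_edge s t a p : path (@adj G T) a p ->
  points_away s t a -> ~ points_away s t (last a p) -> s \in a :: p /\ t \in a :: p.
Proof.
elim: p a => [|b p IHp] a //= /andP[ab bp] sa nl.
have [[-> ->]|[-> ->]|ab'] := edge_cases s t ab.
- by rewrite !inE !eqxx orbT.
- by rewrite !inE !eqxx orbT.
have [h1 h2] := IHp b bp (points_away_step ab' sa) nl.
by rewrite [s \in _]in_cons [t \in _]in_cons h1 h2 !orbT.
Qed.

End Trees.

(** * Almost invariant sets arising from splittings *)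

Section HalfSpaces.
Local Open Scope group_scope.
Variables (G : groupType) (T : gtree G).
Implicit Types (g h x y : G) (a b c d s t u v w : vertex T) (p : seq (vertex T)).

Definition half_set v s t : set G := [set g | points_away s t (act g v)].

Lemma half_set_ltrans g v s t :
  ltrans g (half_set v s t) = half_set v (act g s) (act g t).
Proof.
rewrite ltransE; apply/seteqP; split=> x; rewrite /half_set /= actM.
  by move/(points_away_act g); rewrite actVK.
by move/(points_away_act g^-1); rewrite !actK.
Qed.

Lemma half_setC v s t : adj s t -> ~` half_set v s t = half_set v t s.
Proof. by move=> st; apply/seteqP; split=> x /(points_awayC _ st). Qed.

(** If the edges differ, the second lies on one side of the first; the other side of the first is
    connected and misses the second edge, hence lies on a single side of it. *)
Lemma half_set_nested v a b c d : adj a b -> adj c d ->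
  exists e, corner (half_set v a b) (half_set v c d) e = set0.
Proof.
have corners a' b' c' d' (j : bool) : adj a' b' -> adj c' d' ->
    (forall w, points_away b' a' w -> if j then points_away c' d' w else points_away d' c' w) ->
    corner (half_set v a' b') (half_set v c' d') (false, ~~ j) = set0.
  move=> ab cd sub; apply/corner_eq0; rewrite /= half_setC // => x /sub.
  by rewrite negbK; case: j {sub} => //= h hs; apply: points_away_disjoint hs h.
have key a' b' : adj a' b' -> adj c d -> adj_minus a' b' c d -> points_away a' b' c ->
    exists j, corner (half_set v a' b') (half_set v c d) (false, ~~ j) = set0.
  move=> ab cd abcd abc; have abd := points_away_step abcd abc.
  have [cdb|dcb] := points_away_cover c d b'.
    by exists true; apply: corners => //; apply: points_away_sub.
  exists false; apply: corners => //; apply: points_away_sub => //; first by rewrite adj_sym.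
  by rewrite adj_minus_sym.
move=> ab cd; have [[-> ->]|[-> ->]|abcd] := edge_cases a b cd.
- by exists (true, false); apply/corner_eq0.
- by exists (true, true); apply/corner_eq0; rewrite /= half_setC // adj_sym.
have [abc|bac] := points_away_cover a b c.
  by have [j e] := key a b ab cd abcd abc; exists (false, ~~ j).
have [||j] := key b a _ cd _ bac; [by rewrite adj_sym|by rewrite adj_minusC|].
rewrite corner_eq0 /= half_setC; last by rewrite adj_sym.
by move=> e; exists (true, ~~ j); apply/corner_eq0.
Qed.

(** The edges [g^-1 (s, t)] in question separate [v] from [act x v], so their ends lie on a fixed
    path between these vertices. *)
Lemma half_set_cut v s t x : finite_set
  [set ltrans g^-1 (half_set v s t) |
     g in [set g | half_set v s t g /\ ~ half_set v s t (g * x)]].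
Proof.
have [_ _ _ conn _] := adj_tree T; have [p vp px] := conn v (act x v).
apply: sub_finite_set (finite_image (fun e => half_set v e.1 e.2)
  (finite_setX (finite_seq (v :: p)) (finite_seq (v :: p)))).
move=> _ [g [gs gx] <-]; rewrite half_set_ltrans.
exists (act g^-1 s, act g^-1 t) => //=.
have mem w : w \in map (act g) (v :: p) -> act g^-1 w \in v :: p.
  by case/mapP => z zp ->; rewrite actK.
have gp : path (@adj G T) (act g v) (map (act g) p).
  by rewrite path_map; apply: sub_path vp => a b; rewrite /= act_adj.
have [|/mem ? /mem ?] := separating_edge gp gs; last by split.
by rewrite last_map px -actM.
Qed.

Lemma half_set_ai v s t : almost_invariant (Stab (half_set v s t)) (half_set v s t).
Proof.
split=> [//|x]; set Y := half_set v s t.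
have := half_set_cut v s t x^-1; rewrite -/Y -Hfinite_Stab => f1.
have := half_set_cut v s t x; rewrite -/Y -Hfinite_Stab => f2.
apply: Hfinite_sub (Hfinite_setU f1 (Hfinite_rtrans x f2)) => g /=.
rewrite !rtransE /= mulgVK; tauto.
Qed.

Section Splitting.
Hypothesis splT : is_splitting T.

Lemma splitting_edge s t a b : adj s t -> adj a b ->
  exists g, (act g s = a /\ act g t = b) \/ (act g s = b /\ act g t = a).
Proof. by case: splT => _ _; apply. Qed.

(** If [t] were the only neighbour of [s], transitivity on edges without inversions would make the
    tree a star centred at [t], and [G] would fix [t]. *)
Lemma splitting_branch s t : adj s t -> exists2 u, adj s u & u != t.
Proof.
move=> st; apply: contrapT => nbr.
have leaf u : adj s u -> u = t.
  by move=> su; apply: contrapT => /eqP ut; apply: nbr; exists u.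
have gleaf g w : adj (act g s) w -> w = act g t.
  by rewrite -{1}(actVK g w) act_adj => /leaf <-; rewrite actVK.
have ts : adj t s by rewrite adj_sym.
have noninv g : ~ (act g s = t /\ act g t = s) by exact: act_noninv.
have leaf2 u w : adj t u -> adj u w -> w = t.
  move=> tu; have [g [[gs gt]|[<- gt]]] := splitting_edge st tu; last first.
    by move/gleaf; rewrite gt.
  case: (noninv g); split=> //.
  by have := gleaf g s; rewrite gs => /(_ ts).
have near z : z = t \/ adj t z.
  have [_ _ _ conn _] := adj_tree T; have [p + <-] := conn t z.
  elim/last_ind: p => [|p y IHp]; first by left.
  rewrite rcons_path last_rcons => /andP[/IHp[->|h]]; first by right.
  by move/(leaf2 _ _ h); left.
case: splT => + _ _; apply; exists t => g.
have [//|tgt] := near (act g t); case: (noninv g).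
have gs : act g s = t.
  by apply: leaf2 tgt _; rewrite act_adj.
split=> //; by have := gleaf g s; rewrite gs => /(_ ts).
Qed.

(** The edge is prolonged beyond [t] without backtracking up to a translate with the same direction:
    one step if [t] is in the orbit of [s], two steps otherwise. *)
Lemma points_away_next s t : adj s t -> exists g,
  (forall w, points_away s t w -> points_away (act g s) (act g t) w) /\
  exists2 w, points_away (act g s) (act g t) w & ~ points_away s t w.
Proof.
move=> st; have ts : adj t s by rewrite adj_sym.
suff [g [sub tw]] : exists g,
    (forall w, points_away s t w -> points_away (act g s) (act g t) w) /\
    points_away (act g s) (act g t) t.
  exists g; split=> //; exists t => // stt.
  exact: points_away_disjoint st stt (points_away_refl t s).
have [[k ks]|nk] := pselect (exists k, act k s = t).
  exists k; rewrite ks; split; last exact: points_away_refl.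
  apply: points_away_turn => //; first by rewrite -{1}ks act_adj.
  by apply/eqP => kt; apply: (@act_noninv _ T k s t st).
have [u tu us] := splitting_branch ts; have ut : adj u t by rewrite adj_sym.
have [g [[gs _]|[gs gt]]] := splitting_edge st tu; first by case: nk; exists g.
have [w uw wt] := splitting_branch ut.
have [h [[hs ht]|[_ ht]]] := splitting_edge st uw; last first.
  by case: nk; exists (h^-1 * g); rewrite actM gs -ht actK.
exists h; rewrite hs ht; have sub := points_away_turn tu uw.
split=> [z|]; last by apply: sub; [rewrite eq_sym|exact: points_away_refl].
move=> sz; apply: sub; first by rewrite eq_sym.
by apply: points_away_turn sz; rewrite // eq_sym.
Qed.

Lemma points_away_some v s t : adj s t -> exists g, points_away (act g s) (act g t) v.
Proof.
move=> st; have ts : adj t s by rewrite adj_sym.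
have orb w g : act g s = w -> points_away (act g s) (act g t) w.
  by move=> ->; apply: points_away_refl.
have [_ _ _ conn _] := adj_tree T.
have [w vw] : exists w, adj v w.
  have [[|y p] /= + e] := conn v s; first by exists t; rewrite e.
  by case/andP => vy _; exists y.
have [g [[gs gt]|[gs gt]]] := splitting_edge st vw; first by exists g; apply: orb.
have wv : adj w v by rewrite adj_sym.
have [u wu uv] := splitting_branch wv.
have [h [[hs ht]|[hs ht]]] := splitting_edge st wu.
  exists h; rewrite hs ht; apply: (points_away_turn vw wu); first by rewrite eq_sym.
  exact: points_away_refl.
(* Here [w] is both [act g s] and [act h t], so [g * h^-1] carries it to [act g t = v]. *)
exists (g * h^-1 * g); apply: orb.
by rewrite !actM gs -ht actK gt.
Qed.

(* Otherwise some half-tree in the orbit of that of [(s, t)] would be maximal among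
   those containing [v]; but the tree has no leaf, so it can always be enlarged. *)
Lemma infinite_edges v s t : adj s t ->
  ~ finite_set [set e | exists2 g, e = (act g s, act g t) & points_away e.1 e.2 v].
Proof.
move=> st fin; have [g0 g0v] := points_away_some v st.
pose R (e f : vertex T * vertex T) :=
  (forall w, points_away e.1 e.2 w -> points_away f.1 f.2 w) /\
  exists2 w, points_away f.1 f.2 w & ~ points_away e.1 e.2 w.
have Rtr e f e' : R e f -> R f e' -> R e e'.
  move=> [ef [w fw ew]] [fh _]; split=> [z /ef/fh //|].
  by exists w => //; apply: fh.
have [|[a b] [[g [ga gb] /= gv] mx]] := finite_quasi_maximal Rtr fin.
  by exists (act g0 s, act g0 t); exists g0.
have ab : adj a b by rewrite ga gb act_adj.
have [h [sub [w hw nw]]] := points_away_next ab.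
have [||_ [z abz nz]] := mx (act h a, act h b).
- exists (h * g); first by rewrite !actM ga gb.
  exact: sub.
- by split=> //; exists w.
by apply: nz; apply: sub.
Qed.

(** The inverses of the elements of a right coset of [K] all send the edge to the same edge, and the
    half set yields the infinitely many edges of [infinite_edges]. *)
Lemma half_set_infinite v s t K : adj s t ->
  (forall k, K k -> act k s = s /\ act k t = t) -> ~ Hfinite K (half_set v s t).
Proof.
move=> st sK [F finF sF]; apply: (infinite_edges (v := v) st).
apply: sub_finite_set (finite_image (fun f => (act f^-1 s, act f^-1 t)) finF).
move=> _ [g -> /=] /(points_away_act g^-1); rewrite !actK => gv.
have [f Ff [k /sK[ks kt] kf]] := sF g^-1 gv.
exists f => //; rewrite -[g]invgK -kf invgM !actM.
by rewrite -[in RHS]ks -[in RHS]kt !actK.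
Qed.

End Splitting.

Lemma arises_from_props K Y : is_splitting T -> arises_from T K Y ->
  [/\ K = Stab Y, ntai Y & nested (Sigma Y)].
Proof.
move=> splT [v [s [t [st -> eK sK]]]]; rewrite -/(half_set v s t) in sK *.
have ts : adj t s by rewrite adj_sym.
split=> //.
  split; first exact: half_set_ai.
  rewrite -sK eK; split; first by apply: half_set_infinite.
  by rewrite half_setC //; apply: half_set_infinite => // k [].
have form A : Sigma (half_set v s t) A -> exists a b, adj a b /\ A = half_set v a b.
  move=> [g [->|->]]; rewrite ?half_setC // half_set_ltrans.
    by exists (act g s), (act g t); rewrite act_adj.
  by exists (act g t), (act g s); rewrite act_adj.
move=> A B /form[a [b [ab ->]]] /form[c [d [cd ->]]].
exact: half_set_nested.
Qed.

End HalfSpaces.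

(** * Equivalent sets, their stabilizers, finite generation *)

Section Commensurability.
Local Open Scope group_scope.
Variable G : groupType.
Implicit Types (g x y : G) (H K L X Y Z A B C : set G).

Definition equivalent A B : Prop := small_meet A (~` B) /\ small_meet B (~` A).

Lemma equivalent_refl A : equivalent A A.
Proof. by split; rewrite /small_meet setICr; apply: Hfinite0. Qed.

Lemma equivalent_sym A B : equivalent A B -> equivalent B A.
Proof. by case. Qed.

Lemma equivalent_trans A B C : ntai A -> ntai B -> ntai C ->
  equivalent A B -> equivalent B C -> equivalent A C.
Proof.
move=> nA nB nC [AB BA] [BC CB]; split; first exact: small_meet_trans AB BC.
exact: small_meet_trans CB BA.
Qed.

Lemma equivalentC A B : ntai A -> ntai B -> equivalent A B -> equivalent (~` A) (~` B).
Proof.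
move=> nA nB [AB BA]; rewrite /equivalent !setCK.
by split; apply: small_meetC => //; apply: ntaiC.
Qed.

Lemma equivalent_ltrans g A B : equivalent A B -> equivalent (ltrans g A) (ltrans g B).
Proof. by move=> [AB BA]; split; rewrite -ltransC; apply: small_meet_ltrans. Qed.

Lemma equivalent_Sigma A B C : ntai A -> ntai B -> equivalent A B -> Sigma B C ->
  exists2 D, Sigma A D & equivalent D C.
Proof.
move=> nA nB eAB [g [->|->]].
  by exists (ltrans g A); [exists g; left|apply: equivalent_ltrans].
exists (ltrans g (~` A)); first by exists g; right.
exact/equivalent_ltrans/equivalentC.
Qed.

Lemma equivalent_almost_equal A B : ntai A -> ntai B -> equivalent A B ->
  almost_equal (Stab A) A B.
Proof.
move=> nA nB [AB BA]; apply: Hfinite_setU; first exact: AB.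
have := small_meetC nB (ntaiC nA) BA; rewrite /small_meet StabC.
by apply: Hfinite_sub => x [? ?].
Qed.

Lemma equivalent_Stab_Hfinite H A B : almost_invariant H A -> nontrivial H A ->
  ntai B -> equivalent A B -> Hfinite H (Stab B).
Proof.
move=> aA ntA nB eAB; have nA := ntai_of aA ntA.
have [[A0 Ac0] [B0 Bc0]] := (nontrivial_neq0 nA.2, nontrivial_neq0 nB.2).
apply: (Stab_Hfinite aA _ B0 Bc0); apply: Hfinite_trans (equivalent_almost_equal nA nB eAB).
apply: (Stab_Hfinite aA _ A0 Ac0); rewrite /almost_equal setYK; exact: Hfinite0.
Qed.

(* If [k] stabilizes [B] then [k A] is equivalent to [A], hence nested with it.
   The translates of [A] by [Stab B] are finitely many, so [A] cannot be properly
   contained in [k A]. *)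
Lemma equivalent_Stab_sub A B : ntai A -> ntai B -> nested (Sigma A) ->
  equivalent A B -> Stab B `<=` Stab A.
Proof.
move=> nA nB nest eAB.
have /Hfinite_Stab fin := equivalent_Stab_Hfinite nA.1 nA.2 nB eAB.
have [S1 SM SV] := Stab_subgroup B.
have grow k : Stab B k -> A `<=` ltrans k A -> ltrans k A = A.
  move=> sk sAk; apply/seteqP; split=> //.
  have sub_tr (C D F : set G) : C `<=` D -> D `<=` F -> C `<=` F by exact: subset_trans.
  have [|_ [[x sx <-] mx]] := finite_quasi_maximal sub_tr fin.
    by exists (ltrans 1^-1 A); exists 1.
  have s : ltrans x^-1 (ltrans k A) `<=` ltrans x^-1 A.
    apply: mx; last exact: ltrans_sub.
    by exists (k^-1 * x); [apply: SM => //; apply: SV|rewrite invgM invgK ltransM].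
  by have := ltrans_sub (g := x) s; rewrite !ltransVK.
move=> k sk; have sVk := SV _ sk; rewrite /Stab /=.
have nk := ntai_ltrans k nA.
have [ekA1 ekA2] : equivalent (ltrans k A) A.
  apply: (equivalent_trans (B := B)) => //; last exact: equivalent_sym.
  by have := equivalent_ltrans k eAB; rewrite (sk : ltrans k B = B).
have [|[a b] /corner_eq0] := nest A (ltrans k A) (Sigma_refl A).
  by exists k; left.
have small_of_sub C D : C `<=` D -> small_meet C (~` D).
  by move=> /sub_ai_le/ai_le_small.
case: a b => [] [] /= sA.
- by case: (small_meet_absurd nA _ ekA2); move/small_of_sub: sA; rewrite setCK.
- exact: grow.
- have sk' : ltrans k A `<=` A.
    by have := subsetC sA; rewrite !setCK.
  have : ltrans k^-1 A = A.
    by apply: grow => //; rewrite -{1}(ltransK k A); apply: ltrans_sub.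
  by move=> h; rewrite -{1}h ltransVK.
- case: (small_meet_absurd (ntaiC nA) _ (small_of_sub _ _ sA)).
  by apply: small_meetC => //; apply: ntaiC.
Qed.

Lemma subgroup_smallest S : subgroup (smallest (@subgroup G) S).
Proof.
split=> [|x y Mx My|x Mx] M [sM SM]; have [M1 MM MV] := sM; first exact: M1.
  by apply: MM; [exact: Mx|exact: My].
by apply: MV; exact: Mx.
Qed.

Lemma finitely_generated_conj g H : finitely_generated H ->
  finitely_generated [set x | H (g^-1 * x * g)].
Proof.
move=> [S finS <-]; exists [set g * x * g^-1 | x in S]; first exact: finite_image.
have conj_subgroup h L : subgroup L -> subgroup [set x | L (h^-1 * x * h)].
  move=> [L1 LM LV]; split=> [|x y Lx Ly|x Lx] /=; first by rewrite mulg1 mulVg.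
    have -> : h^-1 * (x * y) * h = (h^-1 * x * h) * (h^-1 * y * h).
      by rewrite !mulgA mulgK.
    exact: LM.
  have -> : h^-1 * x^-1 * h = (h^-1 * x * h)^-1 by rewrite !invgM invgK mulgA.
  exact: LV.
apply/seteqP; split.
  apply: smallest_sub; first exact/conj_subgroup/subgroup_smallest.
  move=> _ [x Sx <-] /=; rewrite !mulgA mulVg mul1g mulgVK.
  exact: sub_gen_smallest.
move=> x /= Hx; have : [set y | smallest (@subgroup G) [set g * x * g^-1 | x in S]
    (g^-1^-1 * y * g^-1)] (g^-1 * x * g).
  apply: Hx; split; first exact/conj_subgroup/subgroup_smallest.
  by move=> y Sy /=; apply: sub_gen_smallest; exists y => //; rewrite invgK.
by rewrite /= invgK !mulgA mulgV mul1g mulgK.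
Qed.

(** A coset [H f] meeting [L] has [f] in [L], so it is enough to add the elements of [F] in [L] to
    the generators of [H]. *)
Lemma finitely_generated_overgroup H L : subgroup L -> finitely_generated H ->
  H `<=` L -> Hfinite H L -> finitely_generated L.
Proof.
move=> sL [S finS <-] sHL [F finF sLF]; have [L1 LM LV] := sL.
exists (S `|` (F `&` L)).
  by rewrite finite_setU; split=> //; apply: finite_setIl.
apply/seteqP; split.
  apply: smallest_sub => // x [Sx|[]//].
  by apply: sHL; apply: sub_gen_smallest.
move=> x Lx; have [f Ff [h Hh hf]] := sLF x Lx; rewrite -hf.
have [_ M _] := subgroup_smallest (S `|` (F `&` L)); apply: M.
  by apply: sub_smallest2r Hh; [exact: subgroup_smallest|move=> y Sy; left].
apply: sub_gen_smallest; right; split=> //.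
have -> : f = h^-1 * x by rewrite -hf mulKg.
by apply: LM => //; apply: LV; apply: sHL.
Qed.

(* Otherwise [Stab Y] would be commensurable with a conjugate of [H]. *)
Lemma inequivalent_not_fg H X Y A B : finitely_generated H -> almost_invariant H X ->
  nontrivial H X -> ntai Y -> nested (Sigma Y) -> ~ finitely_generated (Stab Y) ->
  Sigma X A -> Sigma Y B -> ~ equivalent A B.
Proof.
move=> fgH aX nX nY nest nfg sXA sYB eAB.
have [ntX ntA ntB] : [/\ ntai X, ntai A & ntai B].
  by split; [exact: ntai_of aX nX|exact: ntai_Sigma (ntai_of aX nX) sXA|exact: ntai_Sigma sYB].
have [C sBC eCX] := equivalent_Sigma ntB ntA (equivalent_sym eAB) (Sigma_sym sXA).
have sYC := Sigma_sub sYB sBC; have ntC := ntai_Sigma nY sYC.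
have fgC : finitely_generated (Stab C).
  apply: (finitely_generated_overgroup (Stab_subgroup C) fgH).
    apply: subset_trans (almost_invariant_sub aX) _.
    apply: equivalent_Stab_sub => // D E /(Sigma_sub sYC) sD /(Sigma_sub sYC).
    exact: nest.
  by apply: (equivalent_Stab_Hfinite aX) => //; apply: equivalent_sym.
apply: nfg; have [g [->|->]] := Sigma_sym sYC; rewrite Stab_ltrans ?StabC;
exact: finitely_generated_conj.
Qed.

(** A side common to both corners would be trivial, so the corners are opposite. *)
Lemma small_corners_equivalent A B c d : ntai A -> ntai B -> c != d ->
  small_corner A B c -> small_corner A B d ->
  d = (~~ c.1, ~~ c.2) /\ equivalent (side c.1 A) (side (~~ c.2) B).
Proof.
move=> nA nB; have nside b C : ntai C -> ntai (side b C).
  by case: b => //=; apply: ntaiC.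
have sideC b C : ~` side (~~ b) C = side b C by case: b; rewrite //= setCK.
case: c d => [a b] [a' b']; rewrite !small_cornerE /= => ncd s1 s2.
have [ea|na] := eqVneq a a'.
  have eb : b' = ~~ b by case: b b' {s1 s2} ncd => [] []; rewrite ea ?eqxx.
  move: s2; rewrite -ea eb => s2; case: (small_meet_absurd (nside a A nA) s1).
  by rewrite -[side b B]sideC setCK.
have ea : a' = ~~ a by case: a a' na {ncd s1 s2} => [] [].
have [eb|nb] := eqVneq b b'.
  case: (small_meet_absurd (nside b B nB) (B := side a A)).
    by apply: small_meetC; auto.
  by rewrite -[side a A]sideC setCK -ea eb; apply: small_meetC; auto.
have eb : b' = ~~ b by case: b b' nb {ncd s1 s2} => [] [].
split; first by rewrite ea eb.
split; first by rewrite sideC.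
move: s2; rewrite ea eb => s2; rewrite -[side a A]sideC setCK.
by apply: small_meetC; auto.
Qed.

(** If [ai_le A B] is not an inclusion, [A \ B] is the only small corner; nestedness gives an empty
    corner, which must be that one. *)
Lemma nested_ordered_family Y : ntai Y -> nested (Sigma Y) -> ordered_family (Sigma Y).
Proof.
move=> nY nest; split; first by move=> A; apply: ntai_Sigma.
- exact: SigmaC.
- by move=> x y; apply: finite_separating.
move=> A B sA sB lAB; have [nA nB] := (ntai_Sigma nY sA, ntai_Sigma nY sB).
case/ai_leE: lAB => // -[sAB nsBA].
have [[a b] /corner_eq0] := nest _ _ sA sB.
case: a b => [] [] //= s.
- by case: (small_meet_absurd nA _ sAB); have := ai_le_small (sub_ai_le s); rewrite setCK.
- by case: nsBA; apply/ai_le_small/sub_ai_le; have := subsetC s; rewrite !setCK.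
- have := ai_le_small (sub_ai_le s) => /(small_meetC (ntaiC nA) (ntaiC nB)) t.
  by case: (small_meet_absurd (ntaiC nB) (small_meetC nA (ntaiC nB) sAB) t).
Qed.

(** This transfers finiteness to pairs whose first member comes from a splitting. *)
Lemma bad_dual (P Q : set (set G)) A B : ordered_family P -> ordered_family Q ->
  bad P Q A B -> bad Q P (~` B) (~` A).
Proof.
move=> fP fQ [PA QB lAB A1 nB1]; split=> //; try exact: ofC.
by apply: ai_leC => //; [exact: of_ntai PA|exact: of_ntai QB].
Qed.

End Commensurability.

(** * Combining the orbits of the [X i] and of the splittings *)

Theorem theorem11p1 (G : groupType) (m n : nat)
    (H X : 'I_m -> set G) (sigma : 'I_n -> gtree G) (K Y : 'I_n -> set G)
    (G_fg : finitely_generated [set: G])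
    (H_subgroup : forall i, subgroup (H i))
    (H_fg : forall i, finitely_generated (H i))
    (X_ai : forall i, almost_invariant (H i) (X i))
    (X_nontrivial : forall i, nontrivial (H i) (X i))
    (X_vgp : very_good_position (\bigcup_i Sigma (X i)))
    (sigma_splitting : forall j, is_splitting (sigma j))
    (sigma_noniso : forall j k, j != k -> ~ gtree_iso (sigma j) (sigma k))
    (Y_arises : forall j, arises_from (sigma j) (K j) (Y j))
    (K_nfg : forall j, ~ finitely_generated (K j))
    (XY_sandwiching : satisfies_sandwiching
       (fun k : 'I_m + 'I_n => match k with inl i => X i | inr j => Y j end)) :
  exists (X' : 'I_m -> set G) (Y' : 'I_n -> set G),
    [/\ forall i, almost_invariant (H i) (X' i) /\ almost_equal (H i) (X' i) (X i),
        forall j, almost_invariant (K j) (Y' j) /\ almost_equal (K j) (Y' j) (Y j)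
      & very_good_position
          ((\bigcup_i Sigma (X' i)) `|` (\bigcup_j Sigma (Y' j)))].
Proof.
pose Z (p : 'I_m + 'I_n) := match p with inl i => X i | inr j => Y j end.
have Yprops j := arises_from_props (sigma_splitting j) (Y_arises j).
have nX i : ntai (X i) := ntai_of (X_ai i) (X_nontrivial i).
have nY j : ntai (Y j) by have [_ ? _] := Yprops j.
have nestY j : nested (Sigma (Y j)) by have [_ _ ?] := Yprops j.
have KY j : K j = Stab (Y j) by have [? _ _] := Yprops j.
have nZ p : ntai (Z p) by case: p.
(* Equivalent splittings are replaced by a single one, that of least index. The
   set [a j] then stands for [Y j]. *)
pose sim j k := exists A, Sigma (Y k) A /\ equivalent A (Y j).
have sim_refl j : sim j j.
  exists (Y j); split; first exact: Sigma_refl.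
  exact: equivalent_refl.
have [r r_sim r_min] : exists2 r : 'I_n -> 'I_n, forall j, sim j (r j)
    & forall j k, sim j k -> (r j <= k)%N.
  exists (fun j => [arg min_(k < j | `[< sim j k >]) k]) => [j|j k];
    case: arg_minnP; try exact/asboolP.
  - by move=> k /asboolP.
  - by move=> k' _ mn sk; apply: mn; apply/asboolP.
have [a a_sim] := choice r_sim.
have na j : ntai (a j) := ntai_Sigma (nY (r j)) (a_sim j).1.
have nest_sub j A : Sigma (Y j) A -> nested (Sigma A).
  by move=> sA B C /(Sigma_sub sA) sB /(Sigma_sub sA); apply: nestY.
have Ka j : K j = Stab (a j).
  have [sa ea] := a_sim j; rewrite KY; apply/seteqP; split; last first.
    apply: equivalent_Stab_sub => //; exact: equivalent_sym.
  by apply: equivalent_Stab_sub => //; exact: nest_sub sa.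
(* By transitivity [r j'] is an index whose orbit has a set equivalent to [Y k'], and [r k'] is the
   least such index; the roles are then exchanged. *)
have r_eq j k A B : Sigma (Y (r j)) A -> Sigma (Y (r k)) B -> equivalent A B -> r j = r k.
  have le_r j' k' A' B' : Sigma (Y (r j')) A' -> Sigma (Y (r k')) B' ->
      equivalent A' B' -> (r k' <= r j')%N.
    move=> sA sB eAB; have [sa ea] := a_sim k'; apply: r_min.
    have [nA nB] := (ntai_Sigma (nY _) sA, ntai_Sigma (nY _) sB).
    have [C sC eC] := equivalent_Sigma nA nB eAB (Sigma_sub (Sigma_sym sB) sa).
    have nC := ntai_Sigma nA sC.
    exists C; split; first exact: Sigma_sub sA _ sC.
    exact: equivalent_trans eC ea.
  move=> sA sB eAB; apply/val_inj/eqP; rewrite eqn_leq (le_r _ _ _ _ sA sB eAB).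
  by rewrite (le_r _ _ _ _ sB sA (equivalent_sym eAB)).
pose rho (p : 'I_m + 'I_n) : 'I_m + 'I_n :=
  match p with inl i => inl i | inr j => inr (r j) end.
pose S p := Sigma (Z (rho p)).
pose E : set (set G) := \bigcup_p S p.
have nS p A : S p A -> ntai A by exact: ntai_Sigma.
have EX i A : Sigma (X i) A -> E A by exists (inl i).
have EY j A : Sigma (Y (r j)) A -> E A by exists (inr j).
have fS p : ordered_family (S p).
  case: p => [i|j]; last exact: (nested_ordered_family (nY (r j)) (nestY (r j))).
  split; [exact: (nS (inl i))|exact: SigmaC|by move=> x y; exact: finite_separating|].
  by move=> A B sA sB /X_vgp.2; apply; exists i.
(* [A] and the complement of [B] have a small corner, so each is bounded by the other's orbit; a
   lower bound of the complement of [B] gives an upper bound of [B]. *)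
have sw p q A B : S p A -> S q B -> ai_le A B ->
    (exists2 B', S q B' & ai_le B' A) /\ (exists2 A', S p A' & ai_le B A').
  move=> sA sB lAB; have [nA nB] := (nS _ _ sA, nS _ _ sB); have nBc := ntaiC nB.
  have sAB := ai_le_small lAB; have sBA := small_meetC nA nBc sAB.
  have [B1 [_ [sB1 _ lB1 _]]] :=
    sandwich_small (nZ _) (nZ _) (XY_sandwiching (rho p) (rho q)) sA (SigmaC sB) sAB.
  have [A1 [_ [sA1 _ lA1 _]]] :=
    sandwich_small (nZ _) (nZ _) (XY_sandwiching (rho q) (rho p)) (SigmaC sB) sA sBA.
  split; first by exists B1.
  exists (~` A1); first exact: SigmaC.
  rewrite -[B]setCK; apply: ai_leC => //; exact: ntai_Sigma sA1.
(* If [q] is a splitting, [finite_bad] applies; two orbits of the [X i] have no bad pair, by very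
   good position; the remaining case is dual. *)
have finS p q : finite_set [set A | exists B, bad (S p) (S q) A B].
  case: q => [i|j]; last by case: (finite_bad (fS p) (fS (inr j)) (@nestY _) (@sw _ _)).
  case: p => [i'|j].
    apply: (@sub_finite_set _ _ set0) => // A [B [sA sB lAB A1]]; apply.
    have /X_vgp.2 : ai_le A B := lAB.
    by move=> sAB; apply: sAB A1; [exists i'|exists i].
  have [_ fin] := finite_bad (fS (inl i)) (fS (inr j)) (@nestY _) (@sw _ _).
  apply: sub_finite_set (finite_image (@setC G) fin) => A [B b].
  exists (~` A); last exact: setCK.
  by exists (~` B); apply: bad_dual.
have mE : mesh E.
  split.
  - by move=> A [p _ /nS].
  - by move=> A [p _ sA]; exists p => //; apply: SigmaC.
  - by move=> g A [p _ sA]; exists p => //; apply: Sigma_ltrans.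
  have : finite_set (\bigcup_p \bigcup_q [set A | exists B, bad (S p) (S q) A B]).
    by do 2!(apply: bigcup_finite => [|? _]; first exact: finite_finset).
  apply: sub_finite_set => A [B [[p _ sA] [q _ sB] lAB A1 B1]].
  by exists p => //; exists q => //; exists B.
have gE : good_position E.
  move=> A B EA EB c d ncd sc sd; have [_ EC _ _] := mE.
  have [nA nB] : ntai A /\ ntai B by case: EA EB => [p _ /nS ?] [q _ /nS ?].
  have [ed eq] := small_corners_equivalent nA nB ncd sc sd.
  have Sside b p C : S p C -> S p (side b C) by case: b => //=; apply: SigmaC.
  case: EA EB => [[i|j] _ sA] [[i'|j'] _ sB].
  - by apply: X_vgp.1 => //; [exists i|exists i'].
  - case: (inequivalent_not_fg (H_fg i) (X_ai i) (X_nontrivial i) (nY (r j'))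
      (@nestY _) _ (Sside _ (inl i) _ sA) (Sside _ (inr j') _ sB) eq).
    by rewrite -KY; apply: K_nfg.
  - case: (inequivalent_not_fg (H_fg i') (X_ai i') (X_nontrivial i') (nY (r j))
      (@nestY _) _ (Sside _ (inl i') _ sB) (Sside _ (inr j) _ sA) (equivalent_sym eq)).
    by rewrite -KY; apply: K_nfg.
  - have rjj' := r_eq _ _ _ _ (Sside _ (inr j) _ sA) (Sside _ (inr j') _ sB) eq.
    (* Both sets are in one nested orbit. Its empty corner is [c], or else it is opposite to [c] and
       hence equal to [d]. *)
    rewrite /S /= -rjj' in sB; have [e e0] := @nestY _ _ _ sA sB.
    have [ec|nce] := eqVneq c e; first by left; rewrite ec.
    have se : small_corner A B e by rewrite /small_corner e0; apply: Hfinite0.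
    by have [ee _] := small_corners_equivalent nA nB nce sc se; right; rewrite ed -ee.
have [f [fS' fl fC vgpf]] := very_good_replacement mE gE.
have fSigma C A : E C -> Sigma (f C) A -> exists2 B, Sigma C B & f B = A.
  move=> EC' [g [->|->]]; first by exists (ltrans g C); [exists g; left|rewrite fl].
  by exists (ltrans g (~` C)); [exists g; right|rewrite fl fC].
exists (f \o X), (f \o a); split.
- move=> i /=; have [sf ef] := fS' _ (EX i _ (Sigma_refl _)).
  (* The almost equality holds over [Stab (X i)], which is [H i]-finite. *)
  have {}ef : almost_equal (H i) (f (X i)) (X i).
    apply: Hfinite_trans ef; apply: equivalent_Stab_Hfinite (X_ai i) _ _ _ => //.
    exact: equivalent_refl.
  split=> //; apply: almost_equal_ai ef (X_ai i).
  exact: subset_trans (almost_invariant_sub (X_ai i)) sf.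
- move=> j /=; have [sa ea] := a_sim j; have [] := fS' _ (EY j _ sa).
  have := equivalent_almost_equal (na j) (nY j) ea; rewrite -Ka => eaY sf ef.
  have {}ef : almost_equal (K j) (f (a j)) (Y j) by exact: almost_equal_trans ef eaY.
  split=> //; apply: almost_equal_ai ef _ => //.
  by rewrite KY; case: (nY j).
apply: very_good_position_sub vgpf => A [[i _]|[j _]] /=.
  by case/(fSigma _ _ (EX i _ (Sigma_refl _))) => B sB <-; exists B => //; apply: EX sB.
have [sa _] := a_sim j; case/(fSigma _ _ (EY j _ sa)) => B sB <-.
by exists B => //; apply: (EY j); apply: Sigma_sub sa _ sB.
Qed.
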